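(* Let $\lambda_{\max}>1$ and let $F:[0,\lambda_{\max}]\to\mathbb{R}_+$ be continuously differentiable with $F(0)=0$, such that (i) $F(x)<F^\star$ for all $x\in[0,1)$ and $F'(1)>0$; (ii) $F''$ exists and is continuous on $(0,\lambda_{\max})$ with $F''(1)<0$; (iii) $F^{(3)}$ and $F^{(4)}$ exist and are bounded on $[0,\lambda_{\max}]$; and (iv) $F$ is concave-like. Then there exist constants $C_1,C_2,\varepsilon_0>0$ (depending on $F$) such that for all $\varepsilon\in(0,\varepsilon_0]$, $$\frac{C_1}{\sqrt{\varepsilon}}\le q^\star(\varepsilon)\le\frac{C_2}{\sqrt{\varepsilon}}.$$
   Context: A control policy is a function $\lambda:\mathbb{Z}_+\to[0,\lambda_{\max}]$; it defines a continuous-time birth–death chain on $\mathbb{Z}_+$ with rate $\lambda(q)$ from $q$ to $q+1$ and rate $1$ from $q$ to $q-1$ ($q\ge1$). Let $\mathcal S$ be the set of states reachable from $0$. The policy is stable if $\sum_{i\in\mathcal S}\prod_{q=0}^{i}\lambda(q)<\infty$ (positive recurrence on $\mathcal S$); then $\pi$ is its stationary distribution and $\bar q\sim\pi$. $F^\star=\sup\{\mathbb{E}_\alpha[F(X)]:\alpha$ a probability measure on $[0,\lambda_{\max}]$, $X\sim\alpha$, $\mathbb{E}_\alpha[X]\le1\}$; regret $R(\lambda)=F^\star-\mathbb{E}_\pi[F(\lambda(\bar q))]$; $q^\star(\varepsilon)=\inf\{\mathbb{E}_\pi[\bar q]:\lambda$ stable, $R(\lambda)\le\varepsilon\}$. $F$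 is concave-like if for all $x_1,x_2\in[0,\lambda_{\max}]\setminus\{1\}$, $p\in(0,1)$ with $px_1+(1-p)x_2=1$, we have $F(1)>pF(x_1)+(1-p)F(x_2)$. *)

(* Defs.v *)
From HB Require Import structures.
From mathcomp Require Import all_boot all_order all_algebra.
From mathcomp Require Import all_classical all_reals all_analysis.
From Stdlib Require Import Relations.
Set Implicit Arguments. Unset Strict Implicit. Unset Printing Implicit Defensive.
Import Order.TTheory GRing.Theory Num.Theory.
Import numFieldNormedType.Exports.
Local Open Scope classical_set_scope.
Local Open Scope ring_scope.

Section Defs.
Variable R : realType.

Definition deriv_within (A : set R) (f : R -> R) (x d : R) : Prop :=
  (fun y => (f y - f x) / (y - x)) @ within A (nbhs x^') --> d.

Definition policy (lmax : R) (lam : nat -> R) : Prop :=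
  forall q, 0 <= lam q <= lmax.

(* one transition of the birth-death chain with positive rate:
   q -> q+1 at rate lam q, q -> q-1 at rate 1 (q >= 1) *)
Definition bd_step (lam : nat -> R) : relation nat :=
  fun i j => (j = i.+1 /\ 0 < lam i) \/ (i = j.+1).

Definition reachable (lam : nat -> R) (i : nat) : Prop :=
  clos_refl_trans nat (bd_step lam) 0%N i.

Definition stable (lam : nat -> R) : Prop :=
  (\sum_(0 <= i <oo | `[< reachable lam i >]) (\prod_(q < i.+1) lam q)%:E < +oo)%E.

(* pi is a stationary distribution of the chain on S: a probability
   distribution supported on S satisfying the global balance equations
   pi Q = 0 of the generator Q of the birth-death chain. *)
Definition stationary (lam : nat -> R) (pi : nat -> R) : Prop :=
  [/\ (forall i, 0 <= pi i),
      (forall i, ~ reachable lam i -> pi i = 0),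
      (\sum_(0 <= i <oo) (pi i)%:E = 1)%E &
      (forall j : nat,
         pi j * (lam j + (if (0 < j)%N then 1 else 0)) =
         (if j is k.+1 then pi k * lam k else 0) + pi j.+1)].

(* E_pi[g(qbar)] for nonnegative g *)
Definition Epi (pi : nat -> R) (g : nat -> R) : \bar R :=
  (\sum_(0 <= i <oo) (pi i * g i)%:E)%E.

Definition I0 (lmax : R) : set R := `[0, lmax]%classic.

Definition Fstar (lmax : R) (F : R -> R) : \bar R :=
  ereal_sup [set (\int[P]_(x in I0 lmax) (F x)%:E)%E
            | P in [set P : probability R R |
                     P (I0 lmax) = 1%E /\
                     (\int[P]_(x in I0 lmax) x%:E <= 1)%E]].

Definition regret (lmax : R) (F : R -> R) (lam : nat -> R) (pi : nat -> R)
  : \bar R := (Fstar lmax F - Epi pi (fun q => F (lam q)))%E.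

Definition qstar (lmax : R) (F : R -> R) (eps : R) : \bar R :=
  ereal_inf [set Epi pi (fun i => i%:R)
            | pi in [set pi | exists lam, [/\ policy lmax lam, stable lam,
                        stationary lam pi & (regret lmax F lam pi <= eps%:E)%E]]].

Definition concave_like (lmax : R) (F : R -> R) : Prop :=
  forall x1 x2 p : R, x1 \in `[0, lmax] -> x2 \in `[0, lmax] ->
    x1 != 1 -> x2 != 1 -> 0 < p < 1 -> p * x1 + (1 - p) * x2 = 1 ->
    p * F x1 + (1 - p) * F x2 < F 1.

End Defs.

(* Main.v *)
Require Import Defs.
From Stdlib Require Import Relations.
From HB Require Import structures.
From mathcomp Require Import all_boot all_order all_algebra.
From mathcomp Require Import all_classical all_reals all_analysis.
From mathcomp Require Import measurable_realfun.
From mathcomp Require Import ring lra zify.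
Import Order.TTheory GRing.Theory Num.Theory.
Import numFieldNormedType.Exports.
Local Open Scope classical_set_scope.
Local Open Scope ring_scope.

(* Let a = F'(1) and let G(x) = F(1) + a (x - 1) - F(x) be the gap to the tangent
   line at 1.  Concave-likeness makes G nonnegative, hence F* = F(1), and since
   detailed balance gives E[lambda] = 1 - pi(0), the regret is a pi(0) + E[G(lambda)].
   Near 1, G(x) is of order (x - 1)^2.

   Lower bound: G >= c (x - 1)^2 holds on at least one whole side of 1.  As
   pi(q+1) - pi(q) = pi(q) (lambda(q) - 1), the inequality
   2 s |x - 1| <= (x - 1)^2 + s^2 with s = sqrt eps bounds the total increase (or
   the total decrease) of pi by O(sqrt eps), hence sup pi = O(sqrt eps), and a
   distribution that flat has mean at least of order 1 / sqrt eps.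

   Upper bound: take pi proportional to the square of a tent of width
   n ~ 1 / sqrt eps.  Each state contributes O(1) to the unnormalised cost, while
   the total mass is of order n^3, so the regret is O(1 / n^2). *)

(** * Derivatives on an interval and local second-order bounds *)

Lemma deriv_within_eps {R : realType} {A : set R} {f : R -> R} {x d : R} :
  deriv_within A f x d -> forall e : R, 0 < e ->
  exists2 r : R, 0 < r & forall y, A y -> `|y - x| < r ->
    `|f y - f x - d * (y - x)| <= e * `|y - x|.
Proof.
move=> /cvgrPdist_le H e e0; have := H e e0.
rewrite /nbhs/= /within/= => /nbhs_ballP[r /= r0 Hr]; exists r => // y Ay yr.
have [->|yx] := eqVneq y x; first by rewrite !subrr !mulr0 subrr normr0 mulr0.
have := Hr y; rewrite /ball/= distrC => /(_ yr yx Ay).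
have yx0 : y - x != 0 by rewrite subr_eq0.
have -> : f y - f x - d * (y - x) = ((f y - f x) / (y - x) - d) * (y - x).
  by rewrite mulrBl divfK.
by rewrite normrM distrC => ?; rewrite ler_wpM2r.
Qed.

Lemma deriv_within_continuous {R : realType} {A : set R} {f df : R -> R} :
  (forall x, A x -> deriv_within A f x (df x)) -> {within A, continuous f}.
Proof.
move=> H; apply/subspace_continuousP => x Ax.
apply/cvgrPdist_lt => e e0; rewrite /prop_near1 /nbhs /= /within /=.
have [r r0 Hr] := deriv_within_eps (H x Ax) 1 ltr01.
have D0 : 0 < `|df x| + 1 by rewrite ltr_wpDl.
apply/nbhs_ballP; exists (Num.min r (e / (`|df x| + 1))) => /=.
  by rewrite lt_min r0 divr_gt0.
move=> y; rewrite /ball /= lt_min distrC ltr_pdivlMr// => /andP[yr ye] Ay.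
rewrite distrC.
have := Hr y Ay yr; rewrite mul1r.
have := lerB_dist (f y - f x) (df x * (y - x)); rewrite normrM.
nra.
Qed.

Lemma deriv_within_is_derive {R : realType} {a b : R} {f : R -> R} {x d : R} :
  x \in `]a, b[ -> deriv_within `[a, b] f x d -> is_derive x 1 f d.
Proof.
rewrite in_itv/= => /andP[ax xb] H.
have cv : (fun h : R => h^-1 *: (f (h *: 1 + x) - f x)) @ 0^' --> d.
  apply/cvgrPdist_le => e e0.
  have [r r0 Hr] := deriv_within_eps H e e0.
  rewrite /prop_near1 /nbhs /= /within /=; apply/nbhs_ballP.
  exists (Num.min r (Num.min (x - a) (b - x))) => /=.
    by rewrite !lt_min r0 !subr_gt0 ax xb.
  move=> h; rewrite /ball/= sub0r normrN !lt_min => /and3P[hr ha hb] h0.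
  have := Hr (h + x); rewrite addrK -[_ *: 1]/(h * 1) mulr1 => /(_ _ hr) H'.
  rewrite /GRing.scale/=.
  have -> : d - h^-1 * (f (h + x) - f x) = - (h^-1 * (f (h + x) - f x - d * h)).
    by rewrite [in RHS]mulrBr (mulrC d) mulKf// opprB.
  rewrite normrN normrM normfV ler_pdivrMl ?normr_gt0// [_ * e]mulrC; apply: H'.
  by move: ha hb; rewrite !ltr_norml /= in_itv/=; lra.
by apply: DeriveDef; [apply/cvg_ex; exists d | apply: cvg_lim].
Qed.

Lemma min_of_deriv_sign {R : realType} {h dh : R -> R} {x0 r : R} :
  (forall x, `|x - x0| < r -> is_derive x 1 h (dh x)) ->
  (forall x, `|x - x0| < r -> 0 <= dh x * (x - x0)) ->
  forall x, `|x - x0| < r -> h x0 <= h x.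
Proof.
move=> Hd Hs x; rewrite ltr_norml => /andP[xr1 xr2].
have mvt a b : a < b -> - r < a - x0 -> b - x0 < r ->
    exists2 c, c \in `]a, b[ & h b - h a = dh c * (b - a).
  move=> ab ar br.
  have Hd' y : y \in `[a, b] -> is_derive y 1 h (dh y).
    by rewrite in_itv/= => ?; apply: Hd; rewrite ltr_norml; lra.
  have Hc : {within `[a, b], continuous h}.
    apply: derivable_within_continuous => y yab.
    exact: (@ex_derive _ _ _ _ _ _ _ (Hd' y yab)).
  have Hdo y : y \in `]a, b[ -> is_derive y 1 h (dh y).
    move=> yab; apply: Hd'; move: yab; rewrite !in_itv/=; lra.
  exact: (MVT ab Hdo Hc).
have [xx0|xx0|->//] := ltgtP x x0.
- have [||c] := mvt _ _ xx0; [by lra..|]; rewrite in_itv/= => /andP[c1 c2].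
  by have := Hs c; rewrite ltr_norml => /(_ ltac:(lra)); nra.
- have [||c] := mvt _ _ xx0; [by lra..|]; rewrite in_itv/= => /andP[c1 c2].
  by have := Hs c; rewrite ltr_norml => /(_ ltac:(lra)); nra.
Qed.

(** The factor [s] is later [1] or [-1], so that one computation serves the lower and the upper
    quadratic bound. *)
Lemma is_derive_tangent_quad {R : realType} {F : R -> R} {d c a k s x x0 : R} :
  is_derive x 1 F d ->
  is_derive x 1 (fun y => s * (c + a * (y - x0) - F y - k * (y - x0) ^+ 2))
    (s * (a - d - 2 * k * (x - x0))).
Proof.
move=> H; apply: is_derive_eq.
rewrite /GRing.scale/=; ring.
Qed.

(** The gap minus [k (x - x0)^2] has derivative [F1 x0 - F1 x - 2 k (x - x0)]. As [b] is the
    derivative of [F1] at [x0], the difference [F1 x0 - F1 x] is [- b (x - x0)] up to half its size,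
    which settles the sign for [k = - b / 4] and for [k = - b]. *)
Lemma tangent_gap_local {R : realType} {F F1 : R -> R} {x0 r0 b : R} :
  0 < r0 -> b < 0 ->
  (forall x, `|x - x0| < r0 -> is_derive x 1 F (F1 x)) ->
  is_derive x0 1 F1 b ->
  exists2 r : R, 0 < r & forall x, `|x - x0| < r ->
    - b / 4 * (x - x0) ^+ 2 <= F x0 + F1 x0 * (x - x0) - F x <= - b * (x - x0) ^+ 2.
Proof.
move=> r00 b0 HF [dF1 eF1].
have b4 : 0 < - b / 2 by lra.
have [r r1 Hr] : exists2 r : R, 0 < r & forall x, `|x - x0| < r ->
    `|F1 x - F1 x0 - b * (x - x0)| <= - b / 2 * `|x - x0|.
  have := dF1; rewrite /derivable => /cvg_ex[l Hl].
  have lb : l = b by rewrite -eF1; apply/esym/cvg_lim.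
  rewrite {}lb in Hl.
  move/cvgrPdist_le : Hl => /(_ _ b4).
  rewrite /prop_near1 /nbhs /= /within /= => /nbhs_ballP[r r0' Hr].
  exists r => // x xr.
  have [->|yx] := eqVneq x x0; first by rewrite !subrr !mulr0 subrr normr0 mulr0.
  have h0 : x - x0 != 0 by rewrite subr_eq0.
  have := Hr (x - x0); rewrite /ball /= sub0r normrN => /(_ xr h0).
  rewrite -[_ *: 1]/(_ * 1) mulr1 subrK /GRing.scale/= => H.
  have -> : F1 x - F1 x0 - b * (x - x0) =
      - ((b - (x - x0)^-1 * (F1 x - F1 x0)) * (x - x0)).
    by rewrite mulrBl mulrAC mulVf// mul1r opprB.
  by rewrite normrN normrM ler_wpM2r.
pose r' := Num.min r r0.
have key s k : (forall x, `|x - x0| < r' ->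
     0 <= s * (F1 x0 - F1 x - 2 * k * (x - x0)) * (x - x0)) ->
   forall x, `|x - x0| < r' ->
     0 <= s * (F x0 + F1 x0 * (x - x0) - F x - k * (x - x0) ^+ 2).
  move=> H x xr.
  have H1 y : `|y - x0| < r' -> is_derive y 1
      (fun y => s * (F x0 + F1 x0 * (y - x0) - F y - k * (y - x0) ^+ 2))
      (s * (F1 x0 - F1 y - 2 * k * (y - x0))).
    rewrite lt_min => /andP[_ ?]; apply: is_derive_tangent_quad; exact: HF.
  have /= := min_of_deriv_sign H1 H x xr.
  by rewrite subrr mulr0 addr0 subrr expr0n/= mulr0 subrr mulr0.
exists r'; first by rewrite lt_min r1.
move=> x xr; have := key 1 (- b / 4) _ x xr; have := key (-1) (- b) _ x xr.
have est y : `|y - x0| < r' -> - b / 2 * (y - x0) ^+ 2 <= (F1 x0 - F1 y) * (y - x0)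
    <= - b * 3 / 2 * (y - x0) ^+ 2.
  rewrite lt_min => /andP[/Hr Hy _].
  have := ler_wpM2r (normr_ge0 (y - x0)) Hy.
  rewrite -normrM -(mulrA (- b / 2)) -normrM -expr2 (ger0_norm (sqr_ge0 _)) ler_norml.
  by case/andP => H1 H2; apply/andP; split; lra.
move=> H1 H2; apply/andP; split.
- suff /H2 : forall y, `|y - x0| < r' ->
    0 <= 1 * (F1 x0 - F1 y - 2 * (- b / 4) * (y - x0)) * (y - x0) by lra.
  by move=> y /est/andP[]; lra.
- suff /H1 : forall y, `|y - x0| < r' ->
    0 <= -1 * (F1 x0 - F1 y - 2 * (- b) * (y - x0)) * (y - x0) by lra.
  by move=> y /est/andP[]; nra.
Qed.

(** * The gap to the tangent line at 1 *)

Definition tangent_gap {R : realType} (F : R -> R) (a x : R) : R :=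
  F 1 + a * (x - 1) - F x.

(** The weight [(y - 1) / (y - x)] on [x] gives mean 1, so the affine part averages to [F 1]
    whatever the slope [a]. *)
Lemma tangent_gap_chord {R : realType} {lmax : R} {F : R -> R} (a : R) {x y : R} :
  concave_like lmax F -> 0 <= x < 1 -> 1 < y <= lmax ->
  0 < (y - 1) * tangent_gap F a x + (1 - x) * tangent_gap F a y.
Proof.
move=> H /andP[x0 x1] /andP[y1 yl].
have xy : 0 < y - x by lra.
have xy' : y - x != 0 by rewrite gt_eqF.
have := H x y ((y - 1) / (y - x)).
rewrite !in_itv/= !neq_lt x1 y1 orbT => /(_ ltac:(lra) ltac:(lra) isT isT).
have p01 : 0 < (y - 1) / (y - x) < 1.
  apply/andP; split; first by apply: divr_gt0; lra.
  by rewrite ltr_pdivrMr//; lra.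
move=> /(_ p01).
have -> : 1 - (y - 1) / (y - x) = (1 - x) / (y - x) by field.
move=> /(_ ltac:(by field)).
rewrite !(mulrAC _ _^-1) -mulrDl ltr_pdivrMr// /tangent_gap; nra.
Qed.

(** By [tangent_gap_chord], a negative gap at [x] forces a gap of at least linear order on the other
    side of 1, whereas differentiability makes it [o(s)] at distance [s] from 1. *)
Lemma tangent_gap_ge0 {R : realType} {lmax : R} {F : R -> R} {a : R} :
  1 < lmax -> concave_like lmax F -> deriv_within (I0 lmax) F 1 a ->
  forall x, 0 <= x <= lmax -> 0 <= tangent_gap F a x.
Proof.
move=> l1 HF dF x /andP[x0 xl]; rewrite leNgt; apply/negP => gx.
have x1 : x != 1.
  by apply: contraPneq gx => ->; rewrite /tangent_gap subrr mulr0 addr0 subrr ltxx.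
(* With this tolerance the gap reaches only half of what the chord inequality demands. *)
have e0 : 0 < - tangent_gap F a x / (2 * `|x - 1|).
  by rewrite divr_gt0 ?oppr_gt0// mulr_gt0// normr_gt0 subr_eq0.
have [r r0 Hr] := deriv_within_eps dF _ e0.
pose s := Num.min (r / 2) (Num.min (1 / 2) ((lmax - 1) / 2)).
have [s0 [sr [s1 sl]]] : 0 < s /\ s <= r / 2 /\ s <= 1 / 2 /\ s <= (lmax - 1) / 2.
  by rewrite !lt_min !ge_min !lexx !orbT; split => //; lra.
move: s s0 sr s1 sl => s s0 sr s1 sl.
have gy y : 0 <= y <= lmax -> `|y - 1| = s ->
    `|x - 1| * tangent_gap F a y <= - tangent_gap F a x * s / 2.
  move=> yI ys; have /(Hr y) : I0 lmax y by rewrite /I0/= in_itv/=.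
  rewrite ys.
  move=> /(_ ltac:(lra)); rewrite ler_norml => /andP[+ _] => H.
  have {}H : tangent_gap F a y <= - tangent_gap F a x / (2 * `|x - 1|) * s.
    by move: H; rewrite [tangent_gap F a y]/tangent_gap; lra.
  apply: le_trans (ler_wpM2l (normr_ge0 _) H) _.
  by rewrite le_eqVlt; apply/orP; left; apply/eqP; field; rewrite normr_eq0 subr_eq0.
case: (ltgtP x 1) x1 gy => // xx1 _ gy.
- have := gy (1 + s) ltac:(lra).
  rewrite (addrC 1) addrK (gtr0_norm s0) (@ltr0_norm _ (x - 1)) ?subr_lt0//.
  move=> /(_ erefl).
  have := @tangent_gap_chord R lmax F a x (s + 1) HF ltac:(lra) ltac:(lra).
  rewrite addrK; nra.
- have := gy (1 - s) ltac:(lra).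
  rewrite (addrC 1) addrK normrN (gtr0_norm s0) (@gtr0_norm _ (x - 1)) ?subr_gt0//.
  move=> /(_ erefl).
  have := @tangent_gap_chord R lmax F a (- s + 1) x HF ltac:(lra) ltac:(lra).
  nra.
Qed.

Lemma pos_on_segment_lb {R : realType} {g : R -> R} {u v : R} :
  u <= v -> {within `[u, v], continuous g} -> (forall x, u <= x <= v -> 0 < g x) ->
  exists2 m : R, 0 < m & forall x, u <= x <= v -> m <= g x.
Proof.
move=> uv cg g0; have [c cuv Hc] := EVT_min uv cg.
by exists (g c); [apply: g0|move=> x xuv; apply: Hc].
Qed.

(* [tangent_gap] may vanish away from [1], but by concave-likeness only on one
   side of [1]. *)
Lemma tangent_gap_quadratic {R : realType} {lmax k r : R} {F : R -> R} {a : R} :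
  1 < lmax -> concave_like lmax F ->
  (forall x, 0 <= x <= lmax -> 0 <= tangent_gap F a x) ->
  {within I0 lmax, continuous F} -> 0 < r -> 0 < k ->
  (forall x, `|x - 1| < r -> k * (x - 1) ^+ 2 <= tangent_gap F a x) ->
  exists2 c : R, 0 < c &
    (forall x, 1 <= x <= lmax -> c * (x - 1) ^+ 2 <= tangent_gap F a x) \/
    (forall x, 0 <= x <= 1 -> c * (x - 1) ^+ 2 <= tangent_gap F a x).
Proof.
move=> l1 HF G0 cF r0 k0 Hr.
pose s := Num.min (r / 2) (Num.min (1 / 2) ((lmax - 1) / 2)).
have [s0 [sr [s1 sl]]] : 0 < s /\ s <= r / 2 /\ s <= 1 / 2 /\ s <= (lmax - 1) / 2.
  by rewrite !lt_min !ge_min !lexx !orbT; split => //; lra.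
move: s s0 sr s1 sl => s s0 sr s1 sl.
have cG u v : 0 <= u -> v <= lmax -> {within `[u, v], continuous (tangent_gap F a)}.
  move=> u0 vl; apply: (@continuous_subspaceW _ _ _ (I0 lmax)).
    by move=> z; rewrite /I0 /= !in_itv/=; lra.
  move=> z; apply: cvgB; last exact: cF.
  apply: (@continuous_subspaceT _ _ (I0 lmax) (fun x : R => F 1 + a * (x - 1))).
  move=> {}z; apply: cvgD; first exact: cvg_cst.
  by apply: cvgM; [exact: cvg_cst|apply: cvgB; [exact: cvg_id|exact: cvg_cst]].
have local x : `|x - 1| <= s -> k * (x - 1) ^+ 2 <= tangent_gap F a x.
  by move=> xs; apply: Hr; lra.
(* Away from 1 a constant bound [m] suffices, since [(x - 1)^2 <= lmax^2]. *)
have finish m u v : 0 < m -> 0 <= u -> v <= lmax ->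
    (forall x, u <= x <= v -> s < `|x - 1| -> m <= tangent_gap F a x) ->
    exists2 c : R, 0 < c &
      forall x, u <= x <= v -> c * (x - 1) ^+ 2 <= tangent_gap F a x.
  move=> m0 u0 vl Hm; have l0 : 0 < lmax ^+ 2 by apply: exprn_gt0; lra.
  exists (Num.min k (m / lmax ^+ 2)); first by rewrite lt_min k0 divr_gt0.
  move=> x xuv; have [xs|xs] := lerP `|x - 1| s.
    apply: le_trans (local x xs).
    by rewrite ler_wpM2r ?sqr_ge0// ge_min lexx.
  apply: le_trans (Hm x xuv xs).
  have : 0 <= (lmax - (x - 1)) * (lmax + (x - 1)) by apply: mulr_ge0; lra.
  have : Num.min k (m / lmax ^+ 2) <= m / lmax ^+ 2 by rewrite ge_min lexx orbT.
  have : 0 <= Num.min k (m / lmax ^+ 2).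
    by rewrite le_min (ltW k0) divr_ge0// ltW.
  by rewrite ler_pdivlMr//; nra.
(* If the gap vanishes at some [x2] right of 1, the chords to [x2] make it positive on the left;
   otherwise it is positive on the right. *)
have [[x2 [x2l x20]]|Hno] :=
  pselect (exists x2, 1 + s <= x2 <= lmax /\ tangent_gap F a x2 <= 0).
- have Gpos x : 0 <= x <= 1 - s -> 0 < tangent_gap F a x.
    move=> xI; have := @tangent_gap_chord R lmax F a x x2 HF ltac:(lra) ltac:(lra).
    nra.
  have s_le1 : 0 <= 1 - s by lra.
  have s_lel : 1 - s <= lmax by lra.
  have [m m0 Hm] := pos_on_segment_lb s_le1 (cG _ _ (lexx 0) s_lel) Gpos.
  have Hs x : 0 <= x <= 1 -> s < `|x - 1| -> m <= tangent_gap F a x.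
    by move=> xI xs; apply: Hm; move: xs; rewrite ler0_norm; lra.
  have [c c0 Hc] := finish m 0 1 m0 ltac:(lra) ltac:(lra) Hs.
  by exists c => //; right.
- have Gpos x : 1 + s <= x <= lmax -> 0 < tangent_gap F a x.
    by move=> xI; rewrite ltNge; apply/negP => ?; apply: Hno; exists x.
  have s_ge0 : 0 <= 1 + s by lra.
  have s_lel : 1 + s <= lmax by lra.
  have [m m0 Hm] := pos_on_segment_lb s_lel (cG _ _ s_ge0 (lexx lmax)) Gpos.
  have Hs x : 1 <= x <= lmax -> s < `|x - 1| -> m <= tangent_gap F a x.
    by move=> xI xs; apply: Hm; move: xs; rewrite ger0_norm; lra.
  have [c c0 Hc] := finish m 1 lmax m0 ltac:(lra) ltac:(lra) Hs.
  by exists c => //; left.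
Qed.

(** * The value of [Fstar] *)

(** Integrating [F x <= (F 1 - a) + a x] under a mean at most 1 bounds every competitor by [F 1],
    which the Dirac mass at 1 attains. *)
Lemma Fstar_eq {R : realType} {lmax a : R} {F : R -> R} :
  1 < lmax -> (forall x, 0 <= x <= lmax -> 0 <= F x) -> F 0 = 0 ->
  {within I0 lmax, continuous F} -> 0 <= a ->
  (forall x, 0 <= x <= lmax -> 0 <= tangent_gap F a x) ->
  Fstar lmax F = (F 1)%:E.
Proof.
move=> l1 F0 F00 cF a0 G0.
have mI : measurable (I0 lmax) by exact: measurable_itv.
have mF : measurable_fun (I0 lmax) (fun x => (F x)%:E).
  by apply/measurable_EFinP; exact: subspace_continuous_measurable_fun.
have mid : measurable_fun (I0 lmax) (fun x : R => x%:E).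
  by apply/measurable_EFinP; exact: measurable_id.
have IP x : I0 lmax x -> 0 <= x <= lmax by rewrite /I0/= in_itv.
apply/eqP; rewrite eq_le; apply/andP; split.
- apply: ge_ereal_sup => _ [P [P1 Pm] <-].
  have Fa : 0 <= F 1 - a.
    by have := G0 0; rewrite /tangent_gap F00 lexx => /(_ ltac:(lra)); lra.
  apply: (@le_trans _ _ (\int[P]_(x in I0 lmax) ((F 1 - a)%:E + a%:E * x%:E))%E).
    apply: ge0_le_integral => //.
    + apply: emeasurable_funD; first exact: measurable_cst.
      by apply: emeasurable_funM => //; exact: measurable_cst.
    + move=> x /IP/G0; rewrite /tangent_gap -EFinM -EFinD lee_fin; lra.
  rewrite ge0_integralD//.
  + rewrite integral_cst// [X in (_ * X + _)%E](P1 : _ = 1%E) mule1 ge0_integralZl//.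
    * apply: (@le_trans _ _ ((F 1 - a)%:E + a%:E * 1)%E).
        by rewrite leeD2l// lee_wpmul2l.
      by rewrite mule1 -EFinD subrK.
    * by move=> x /IP/andP[? _]; rewrite lee_fin.
  + by move=> x /IP/andP[? _]; rewrite -EFinM lee_fin mulr_ge0.
  + by apply: emeasurable_funM => //; exact: measurable_cst.
- apply: ereal_sup_ubound; exists (dirac (1 : R)).
    split; first by rewrite /= diracE mem_set// /I0/= in_itv/= ler01 ltW.
    rewrite integral_dirac//.
    by rewrite diracE mem_set ?mul1e// /I0/= in_itv/= ler01 ltW.
  by rewrite integral_dirac// diracE mem_set ?mul1e// /I0/= in_itv/= ler01 ltW.
Qed.

(** * Detailed balance and series of nonnegative terms *)

(** By induction, the flows across the edge below [j.+1] cancel in the balance equation there,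
    leaving those across the edge above. *)
Lemma stationary_detailed_balance {R : realType} {lam pi : nat -> R} :
  stationary lam pi -> forall j, pi j.+1 = pi j * lam j.
Proof.
move=> [_ _ _ bal]; elim=> [|j IH].
  by have := bal 0%N; rewrite ltnn /= addr0 add0r.
have := bal j.+1; rewrite ltn0Sn -IH mulrDr mulr1 addrC => /addrI ->.
by [].
Qed.

Lemma eseries_eq_sum {R : realType} {u : nat -> \bar R} (P : pred nat) {n : nat} :
  (forall i, (n <= i)%N -> u i = 0%E) ->
  (\sum_(0 <= i <oo | P i) u i = \sum_(0 <= i < n | P i) u i)%E.
Proof.
move=> u0; apply: lim_near_cst => //; near=> m.
have nm : (n <= m)%N by near: m; exact: nbhs_infty_ge.
rewrite (big_cat_nat _ nm)//= [X in (_ + X)%E](_ : _ = 0%E) ?adde0//.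
by rewrite big_nat_cond big1// => i /andP[/andP[ni _] _]; exact: u0.
Unshelve. all: by end_near. Qed.

Section RealSeries.
Context {R : realType} {p : nat -> R}.
Hypothesis p0 : forall i, 0 <= p i.

Lemma sum_le_series n :
  ((\sum_(0 <= i < n) p i)%:E <= \sum_(0 <= i <oo) (p i)%:E)%E.
Proof.
rewrite -sumEFin; apply: (@nneseries_lim_ge _ (fun i => (p i)%:E) xpredT 0%N n).
by move=> i _ _; rewrite lee_fin.
Qed.

Lemma series_le (c : R) m :
  (forall n, (m <= n)%N -> \sum_(0 <= i < n) p i <= c) ->
  (\sum_(0 <= i <oo) (p i)%:E <= c%:E)%E.
Proof.
move=> H; apply: lime_le.
  by apply: is_cvg_nneseries => i _ _; rewrite lee_fin.
near=> n; rewrite sumEFin lee_fin; apply: H.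
by near: n; exact: nbhs_infty_ge.
Unshelve. all: by end_near. Qed.

Lemma sum_gt_near (c : R) : (c%:E < \sum_(0 <= i <oo) (p i)%:E)%E ->
  exists N, forall n, (N <= n)%N -> c < \sum_(0 <= i < n) p i.
Proof.
move=> H; have [N HN] : exists N, c < \sum_(0 <= i < N) p i.
  apply: contrapT => /forallNP Hn; move: H; rewrite ltNge => /negP; apply.
  by apply: (@series_le _ 0%N) => n _; rewrite leNgt; exact/negP.
exists N => n Nn; apply: lt_le_trans HN _.
by rewrite (big_cat_nat _ Nn)//= lerDl sumr_ge0.
Qed.

End RealSeries.

(** * Lower bound: consequences of a small regret *)

Section Regret.
Context {R : realType} {lmax a : R} {F : R -> R} {lam pi : nat -> R}.
Hypothesis a0 : 0 <= a.
Hypothesis F0 : forall x, 0 <= x <= lmax -> 0 <= F x.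
Hypothesis aF : a <= F 1.
Hypothesis FstarE : Fstar lmax F = (F 1)%:E.
Hypothesis G0 : forall x, 0 <= x <= lmax -> 0 <= tangent_gap F a x.
Hypothesis lamP : policy lmax lam.
Hypothesis statP : stationary lam pi.

Let pi0 i : 0 <= pi i. Proof. by case: statP. Qed.

Let pi_sum : (\sum_(0 <= i <oo) (pi i)%:E)%E = 1%E. Proof. by case: statP. Qed.

Lemma sum_pi_le1 n : \sum_(0 <= i < n) pi i <= 1.
Proof. by rewrite -lee_fin -pi_sum; exact: sum_le_series. Qed.

(* Detailed balance turns the linear part of [tangent_gap] into the mass
   missing from the mean arrival rate, namely [pi 0]. *)
Lemma regret_ge_gap {eps : R} : (regret lmax F lam pi <= eps%:E)%E ->
  forall m, a * pi 0%N + \sum_(0 <= i < m) pi i * tangent_gap F a (lam i) <= eps.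
Proof.
move=> reg m.
have piF0 i : 0 <= pi i * F (lam i) by rewrite mulr_ge0// F0.
have up n : (m <= n)%N -> \sum_(0 <= i < n) pi i * F (lam i) <=
    F 1 - a * pi 0%N - \sum_(0 <= i < m) pi i * tangent_gap F a (lam i).
  move=> mn.
  have -> : \sum_(0 <= i < n) pi i * F (lam i) =
      (F 1 - a) * (\sum_(0 <= i < n) pi i) + a * (\sum_(0 <= i < n) pi i.+1)
      - \sum_(0 <= i < n) pi i * tangent_gap F a (lam i).
    rewrite !big_distrr/= -big_split/= -sumrB; apply: eq_bigr => i _.
    rewrite (stationary_detailed_balance statP) /tangent_gap; ring.
  have -> : \sum_(0 <= i < n) pi i.+1 = \sum_(0 <= i < n.+1) pi i - pi 0%N.
    by rewrite big_nat_recl// addrC addKr.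
  (* Both [F 1 - a] and [a] are nonnegative, so partial masses may be replaced by 1. *)
  have F1a : 0 <= F 1 - a by rewrite subr_ge0.
  have := ler_wpM2l F1a (sum_pi_le1 n); have := ler_wpM2l a0 (sum_pi_le1 n.+1).
  rewrite (big_cat_nat _ mn (F := fun i => _ * tangent_gap _ _ _))//=.
  have : 0 <= \sum_(m <= i < n) pi i * tangent_gap F a (lam i).
    by rewrite sumr_ge0// => i _; rewrite mulr_ge0// G0.
  lra.
(* These two bounds make the series finite, so the subtraction in [regret] is one of reals. *)
have := series_le piF0 _ m up; have := sum_le_series piF0 0%N.
move: reg; rewrite /regret FstarE /Epi big_nil.
case: (limn _) => [e| |]//; rewrite -EFinB !lee_fin; lra.
Qed.

(** The increments of [pi] telescope, and the pointwise hypothesis charges each to the regret; the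
    extra [c eps] adds up to at most [c eps] because [pi] has mass 1. The sign [sg] selects rises or
    falls. *)
Lemma drift_sum_le {eps c s sg : R} : 0 <= c -> 0 < eps ->
  (regret lmax F lam pi <= eps%:E)%E ->
  (forall x, 0 <= x <= lmax ->
    2 * c * s * (sg * (x - 1)) <= tangent_gap F a x + c * eps) ->
  forall m n, (m <= n)%N -> 2 * c * s * (sg * (pi n - pi m)) <= (1 + c) * eps.
Proof.
move=> c0 e0 reg H m n mn.
have -> : pi n - pi m = \sum_(m <= i < n) (pi i * (lam i - 1)).
  rewrite -(telescope_sumr _ mn); apply: eq_bigr => i _.
  by rewrite (stationary_detailed_balance statP); ring.
have t0 i : 0 <= pi i * (tangent_gap F a (lam i) + c * eps).
  by rewrite mulr_ge0// addr_ge0 ?G0// mulr_ge0// ltW.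
rewrite !big_distrr/=.
apply: (@le_trans _ _
    (\sum_(0 <= i < n) pi i * (tangent_gap F a (lam i) + c * eps))).
  rewrite (@big_cat_nat _ _ _ m 0%N n)//= ler_wpDl ?sumr_ge0//.
  apply: ler_sum => i _.
  by have := ler_wpM2l (pi0 i) (H _ (lamP i)); lra.
under eq_bigr do rewrite mulrDr; rewrite big_split/= -big_distrl/=.
have := regret_ge_gap reg n; have := sum_pi_le1 n.
have := mulr_ge0 a0 (pi0 0%N); have := mulr_ge0 c0 (ltW e0); nra.
Qed.

Lemma pi_vanishes m (eta : R) : 0 < eta -> exists2 n, (m <= n)%N & pi n < eta.
Proof.
move=> eta0; have [|N HN] := sum_gt_near pi0 (1 - eta).
  by rewrite pi_sum lte_fin; lra.
exists (maxn m N); first exact: leq_maxl.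
have := HN _ (leq_maxr m N); have := sum_pi_le1 (maxn m N).+1.
by rewrite big_nat_recr//=; lra.
Qed.

(** If the gap is quadratic right of 1, [pi m] exceeds [pi 0] by a bounded rise, and
    [pi 0 <= eps / a]. If it is quadratic left of 1, falls are bounded, yet [pi] must fall from
    [pi m] to nearly 0. *)
Lemma stationary_sup_le {eps c : R} : 0 < a -> 0 < c -> 0 < eps <= 1 ->
  (regret lmax F lam pi <= eps%:E)%E ->
  (forall x, 1 <= x <= lmax -> c * (x - 1) ^+ 2 <= tangent_gap F a x) \/
    (forall x, 0 <= x <= 1 -> c * (x - 1) ^+ 2 <= tangent_gap F a x) ->
  forall m, pi m <= (a^-1 + (1 + c) / (2 * c)) * Num.sqrt eps.
Proof.
move=> apos c0 /andP[e0 e1] reg Hc m.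
have s0 : 0 < Num.sqrt eps by rewrite sqrtr_gt0.
have s1 : Num.sqrt eps <= 1 by rewrite -sqrtr1 ler_sqrt.
have : Num.sqrt eps ^+ 2 = eps by rewrite sqr_sqrtr// ltW.
set s := Num.sqrt eps in s0 s1 * => es.
have iap : 0 < a^-1 by rewrite invr_gt0.
have flow (d : R) : 2 * c * s * d <= (1 + c) * eps -> d <= (1 + c) / (2 * c) * s.
  move=> H; have cs0 : 0 < 2 * c * s by rewrite !mulr_gt0.
  rewrite -(ler_pM2l cs0); apply: le_trans H _; rewrite -es le_eqVlt.
  by apply/orP; left; apply/eqP; field; rewrite gt_eqF.
have gap x : 0 <= x <= lmax -> 0 <= tangent_gap F a x + c * eps.
  by move=> /G0 ?; rewrite addr_ge0// mulr_ge0// ltW.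
case: Hc => Hc.
(* Right of 1, expand [c (x - 1 - s)^2 >= 0]; left of 1, the left-hand side is negative. *)
- have H x : 0 <= x <= lmax -> 2 * c * s * (1 * (x - 1)) <= tangent_gap F a x + c * eps.
    move=> xI; have [x1|x1] := lerP 1 x.
      have := Hc x ltac:(lra); have := mulr_ge0 (ltW c0) (sqr_ge0 (x - 1 - s)).
      by rewrite -es; nra.
    apply: le_trans (gap x xI).
    by rewrite mul1r pmulr_rle0 ?mulr_gt0//; lra.
  have := flow _ (drift_sum_le (ltW c0) e0 reg H 0%N m (leq0n m)).
  have := regret_ge_gap reg 0%N; rewrite big_nil addr0 mul1r -es => H0.
  have : pi 0%N <= a^-1 * s.
    rewrite ler_pdivlMl//; apply: le_trans H0 _; nra.
  by lra.
- have H x : 0 <= x <= lmax -> 2 * c * s * (-1 * (x - 1)) <= tangent_gap F a x + c * eps.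
    move=> xI; have [x1|x1] := lerP x 1.
      have := Hc x ltac:(lra); have := mulr_ge0 (ltW c0) (sqr_ge0 (x - 1 + s)).
      by rewrite -es; nra.
    apply: le_trans (gap x xI).
    by rewrite mulN1r pmulr_rle0 ?mulr_gt0//; lra.
  rewrite leNgt; apply/negP => big.
  (* This level is positive by [big], so [pi] later drops below it, a larger fall than allowed. *)
  have [|n mn Hn] := pi_vanishes m (pi m - (1 + c) / (2 * c) * s).
    by have := mulr_gt0 iap s0; lra.
  by have := flow _ (drift_sum_le (ltW c0) e0 reg H m n mn); lra.
Qed.

(* A probability on [nat] bounded by [B] puts at most half of its mass on
   [0, 1 / (2 B)). *)
Lemma mean_ge_of_sup_le {B : R} : 0 < B -> B <= 1 / 4 ->
  (forall m, pi m <= B) -> ((1 / (16 * B))%:E <= Epi pi (fun i => i%:R))%E.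
Proof.
move=> B0 B4 H; pose n := Num.truncn (1 / (2 * B)).
have /andP[n1 n2] : n%:R <= 1 / (2 * B) < n.+1%:R.
  by apply: truncn_itv; rewrite divr_ge0// mulr_ge0// ltW.
have nB : n%:R * B <= 1 / 2.
  by move: n1; rewrite ler_pdivlMr ?mulr_gt0//; lra.
(* Rounding down loses at most [B <= 1 / 4] out of [1 / 2]. *)
have nB2 : 1 / 4 <= n%:R * B.
  by move: n2; rewrite ltr_pdivrMr ?mulr_gt0// -natr1; lra.
(* Of a mass above [3 / 4], at most [1 / 2] lies below [n]; the rest, over [1 / 4], lies at states
   [>= n >= 1 / (4 B)]. *)
have [|N HN] := sum_gt_near pi0 (3 / 4); first by rewrite pi_sum lte_fin; lra.
apply: (@le_trans _ _ (\sum_(0 <= i < maxn n N) pi i * i%:R)%:E); last first.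
  by apply: sum_le_series => i; rewrite mulr_ge0.
rewrite lee_fin (@big_cat_nat _ _ _ n 0%N _)//= ?leq_maxl//.
apply: ler_wpDl; first by rewrite sumr_ge0// => i _; rewrite mulr_ge0.
apply: (@le_trans _ _ (n%:R * \sum_(n <= i < maxn n N) pi i)); last first.
  rewrite big_distrr/=; apply: ler_sum_nat => i /andP[ni _].
  by rewrite mulrC ler_wpM2l// ler_nat.
have : \sum_(0 <= i < n) pi i <= n%:R * B.
  apply: (@le_trans _ _ (\sum_(0 <= i < n) B)); first by apply: ler_sum.
  by rewrite sumr_const_nat subn0 mulr_natl.
have := HN _ (leq_maxr n N).
rewrite (@big_cat_nat _ _ _ n 0%N _)//= ?leq_maxl// => H1 H2.
rewrite ler_pdivrMr ?mulr_gt0//.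
have := ler0n R n; nra.
Qed.

End Regret.

(** * Upper bound: chains with finitely supported weights *)

(* Prescribing the stationary weights [w] of a chain on [0, N] forces the rates
   [w i.+1 / w i]; beyond [N] they are [0 / 0 = 0]. *)
Section FiniteChain.
Context {R : realType} {lmax a : R} {F : R -> R} {w : nat -> R} {N : nat}.
Hypothesis w_gt0 : forall i, (i <= N)%N -> 0 < w i.
Hypothesis w_eq0 : forall i, (N < i)%N -> w i = 0.
Let W := \sum_(0 <= i < N.+1) w i.
Let lam i := w i.+1 / w i.
Let pi i := w i / W.

Let w_ge0 i : 0 <= w i.
Proof. by have [/w_gt0/ltW|/w_eq0->] := leqP i N. Qed.

Let W_gt0 : 0 < W.
Proof.
by rewrite /W big_nat_recr//= ltr_wpDl ?w_gt0// sumr_ge0.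
Qed.

Let pi_eq0 i : (N < i)%N -> pi i = 0.
Proof. by rewrite /pi => /w_eq0 ->; rewrite mul0r. Qed.

Let sum_pi : \sum_(0 <= i < N.+1) pi i = 1.
Proof. by rewrite -big_distrl/= divff// gt_eqF. Qed.

Let balance i : pi i * lam i = pi i.+1.
Proof.
rewrite /pi /lam; have [iN|iN] := leqP i N.
  by field; rewrite !gt_eqF// w_gt0.
by rewrite (w_eq0 _ iN) (w_eq0 _ (ltnW (iN : (N.+1 < i.+1)%N))) !mul0r.
Qed.

(** Already [lam N = 0 / w N] is 0, so the products vanish from index [N] on. *)
Lemma finite_chain_stable : stable lam.
Proof.
rewrite /stable (@eseries_eq_sum _ _ _ N).
  by rewrite sumEFin ltry.
move=> i Ni; rewrite (bigD1 (Ordinal (ltnSn i)))//=.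
by rewrite /lam w_eq0 ?ltnS// !mul0r.
Qed.

Lemma finite_chain_stationary : stationary lam pi.
Proof.
split.
- by move=> i; rewrite divr_ge0// ltW.
- move=> i nr; rewrite pi_eq0// ltnNge; apply/negP => iN; apply: nr.
  rewrite /reachable; elim: i iN => [|i IH] iN; first exact: rt_refl.
  apply: rt_trans (IH (ltnW iN)) _; apply: rt_step; left; split => //.
  by rewrite divr_gt0 ?w_gt0// ltnW.
- rewrite (@eseries_eq_sum _ _ _ N.+1) => [|i /pi_eq0 ->//].
  by rewrite sumEFin sum_pi.
- move=> [|j] /=; first by rewrite addr0 add0r balance.
  by rewrite mulrDr mulr1 !balance addrC.
Qed.

(** The decomposition behind [regret_ge_gap] is an equality here: [pi] has finite support and
    [pi N.+1 = 0]. *)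
Lemma finite_chain_regret : Fstar lmax F = (F 1)%:E ->
  regret lmax F lam pi = ((a * w 0%N +
    \sum_(0 <= i < N.+1) w i * tangent_gap F a (lam i)) / W)%:E.
Proof.
rewrite /regret /Epi => ->.
rewrite (@eseries_eq_sum _ _ _ N.+1) => [|i /pi_eq0 ->]; last by rewrite mul0r.
rewrite sumEFin -EFinB; congr EFin.
have -> : \sum_(0 <= i < N.+1) pi i * F (lam i) =
    (F 1 - a) * (\sum_(0 <= i < N.+1) pi i) + a * (\sum_(0 <= i < N.+1) pi i.+1)
    - \sum_(0 <= i < N.+1) pi i * tangent_gap F a (lam i).
  rewrite !big_distrr/= -big_split/= -sumrB; apply: eq_bigr => i _.
  by rewrite -balance /tangent_gap; ring.
have -> : \sum_(0 <= i < N.+1) pi i.+1 = 1 - pi 0%N.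
  have : \sum_(0 <= i < N.+2) pi i = 1 by rewrite big_nat_recr//= sum_pi pi_eq0 ?addr0.
  by rewrite big_nat_recl// => <-; rewrite addrC addKr.
have -> : \sum_(0 <= i < N.+1) pi i * tangent_gap F a (lam i) =
    (\sum_(0 <= i < N.+1) w i * tangent_gap F a (lam i)) / W.
  by rewrite big_distrl/=; apply: eq_bigr => i _; rewrite /pi mulrAC.
by rewrite sum_pi /pi; field; rewrite gt_eqF.
Qed.

Lemma qstar_le_finite_chain {eps : R} : Fstar lmax F = (F 1)%:E ->
  policy lmax lam ->
  a * w 0%N + \sum_(0 <= i < N.+1) w i * tangent_gap F a (lam i) <= eps * W ->
  (qstar lmax F eps <= N%:R%:E)%E.
Proof.
move=> FsE pol H.
apply: (@le_trans _ _ (Epi pi (fun i => i%:R))).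
  apply: ereal_inf_lbound; exists pi => //; exists lam; split => //.
  - exact: finite_chain_stable.
  - exact: finite_chain_stationary.
  - by rewrite finite_chain_regret// lee_fin ler_pdivrMr.
rewrite /Epi (@eseries_eq_sum _ _ _ N.+1) => [|i /pi_eq0 ->]; last by rewrite mul0r.
have -> : N%:R = \sum_(0 <= i < N.+1) pi i * N%:R.
  by rewrite -big_distrl/= sum_pi mul1r.
rewrite sumEFin lee_fin.
apply: ler_sum_nat => i /andP[_ iN].
by rewrite ler_wpM2l ?ler_nat// /pi divr_ge0// ltW.
Qed.

End FiniteChain.

(** * Tent weights and the resulting upper bound *)

(** The offset [k] keeps the heights at least [k], so that ratios of consecutive squares stay within
    [3 / k] of 1 before the last state. *)
Definition tent (k n q : nat) : nat := minn q (n.*2 - q) + k.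

(** At height [x] the ratio of consecutive squares is within [3 / x] of 1, so the weight [x^2] times
    the squared deviation stays bounded. *)
Definition tent_weight {R : realType} (k n q : nat) : R :=
  if (q <= n.*2)%N then (tent k n q)%:R ^+ 2 else 0.

Lemma tent_weight_gt0 {R : realType} {k n i : nat} :
  (0 < k)%N -> (i <= n.*2)%N -> 0 < tent_weight k n i :> R.
Proof.
by move=> k0 ni; rewrite /tent_weight ni exprn_gt0// ltr0n /tent; lia.
Qed.

Lemma tent_weight_eq0 {R : realType} {k n i : nat} :
  (n.*2 < i)%N -> tent_weight k n i = 0 :> R.
Proof. by rewrite /tent_weight ltnNge => /negbTE ->. Qed.

(** The rising half suffices: there the tent is at least [q]. *)
Lemma sum_tent_weight_ge {R : realType} (k n : nat) :
  n%:R ^+ 3 / 3 <= \sum_(0 <= q < n.*2.+1) tent_weight k n q :> R.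
Proof.
have sq m : m%:R ^+ 3 / 3 <= \sum_(0 <= q < m.+1) q%:R ^+ 2 :> R.
  elim: m => [|m IH]; first by rewrite big_nat1 !expr0n/= mul0r.
  rewrite big_nat_recr//= -natr1; have := ler0n R m; nra.
have nn : (n.+1 <= n.*2.+1)%N by lia.
rewrite (big_cat_nat _ nn)//=; apply: ler_wpDr.
  by rewrite sumr_ge0// => q _; rewrite /tent_weight; case: ifP => // _; rewrite exprn_ge0.
apply: le_trans (sq n) _.
apply: ler_sum_nat => q /andP[_ qn]; rewrite /tent_weight ifT; last by lia.
by rewrite lerXn2r ?nnegrE ?ler0n// ler_nat /tent; lia.
Qed.

Lemma square_ratio_near1 {R : realType} (x y : R) : 1 <= x -> `|y - x| <= 1 ->
  `|y ^+ 2 / x ^+ 2 - 1| <= 3 / x.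
Proof.
move=> x1 yx; have x0 : 0 < x by lra.
have -> : y ^+ 2 / x ^+ 2 - 1 = (y - x) * (y + x) / x ^+ 2.
  by field; rewrite gt_eqF.
have -> : 3 / x = 3 * x / x ^+ 2 by field; rewrite gt_eqF.
rewrite normrM normfV (ger0_norm (sqr_ge0 x)) ler_wpM2r ?invr_ge0 ?sqr_ge0//.
rewrite normrM -[leRHS]mul1r ler_pM//.
by move: yx; rewrite !ler_norml; lra.
Qed.

(** The boundary terms cost [k^2 F 1] and each of the [2 n] states below the top at most [9 D],
    against a mass of at least [n^3 / 3], while the mean is at most [2 n]. *)
Lemma qstar_upper {R : realType} {lmax a D r : R} {F : R -> R} :
  1 < lmax -> Fstar lmax F = (F 1)%:E -> F 0 = 0 -> 0 <= F 1 ->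
  0 < D -> 0 < r ->
  (forall x, `|x - 1| < r -> tangent_gap F a x <= D * (x - 1) ^+ 2) ->
  exists2 C : R, 0 < C & forall eps : R, 0 < eps <= 1 ->
    (qstar lmax F eps <= (C / Num.sqrt eps)%:E)%E.
Proof.
move=> l1 FsE F00 F10 D0 r0 HD.
(* The bound [lmax - 1] keeps the rates below [lmax]. *)
pose rho := Num.min r (lmax - 1).
have rho0 : 0 < rho by rewrite lt_min r0 subr_gt0.
have [k k1 k3] : exists2 k : nat, (0 < k)%N & 3 / k%:R < rho.
  exists (Num.truncn (3 / rho)).+1 => //.
  by rewrite ltr_pdivrMr ?ltr0n// mulrC -ltr_pdivrMr//; exact: truncnS_gt.
have k0 : 0 < k%:R :> R by rewrite ltr0n.
have ratio n q : (q < n.*2)%N -> let x : R := (tent k n q)%:R in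
    let l := (tent_weight k n q.+1 / tent_weight k n q) : R in
    [/\ 0 < x, tent_weight k n q = x ^+ 2, `|l - 1| <= 3 / x & `|l - 1| < rho].
  move=> qn x l.
  have tq : (k <= tent k n q)%N by rewrite /tent; lia.
  have x1 : 1 <= x by rewrite ler1n; lia.
  have x0 : 0 < x by lra.
  have wE : tent_weight k n q = x ^+ 2 by rewrite /tent_weight ifT//; lia.
  have lE : `|l - 1| <= 3 / x.
    rewrite /l wE {1}/tent_weight qn; apply: square_ratio_near1 => //.
    have : (tent k n q.+1 <= (tent k n q).+1)%N by rewrite /tent; lia.
    have : (tent k n q <= (tent k n q.+1).+1)%N by rewrite /tent; lia.
    rewrite -!(ler_nat R) -!natr1 -/x ler_norml; lra.
  split => //; apply: le_lt_trans lE (le_lt_trans _ k3).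
  by rewrite ler_pM2l// lef_pV2 ?posrE// ler_nat.
(* Chosen so that [k^2 F 1 + 18 D n <= B n / 3] once [n >= 1]; then [B <= eps n^2] suffices. *)
pose B := 3 * (k%:R ^+ 2 * F 1 + 18 * D).
have B0 : 0 < B by rewrite mulr_gt0// ltr_wpDl ?mulr_ge0 ?mulr_gt0// exprn_ge0.
exists (2 * (Num.sqrt B + 1)); first by rewrite mulr_gt0// ltr_wpDl// sqrtr_ge0.
move=> eps /andP[e0 e1].
have s0 : 0 < Num.sqrt eps by rewrite sqrtr_gt0.
have s1 : Num.sqrt eps <= 1 by rewrite -sqrtr1 ler_sqrt.
have es : Num.sqrt eps ^+ 2 = eps by rewrite sqr_sqrtr// ltW.
have bs : Num.sqrt B ^+ 2 = B by rewrite sqr_sqrtr// ltW.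
have sB0 := sqrtr_ge0 B.
(* Rounding [sqrt (B / eps)] up secures [B <= eps n^2]. *)
have [n n0 /andP[n1 n2]] : exists2 n : nat, (0 < n)%N &
    Num.sqrt B / Num.sqrt eps < n%:R <= Num.sqrt B / Num.sqrt eps + 1.
  exists (Num.truncn (Num.sqrt B / Num.sqrt eps)).+1 => //.
  by rewrite truncnS_gt -natr1 lerD2r truncn_le divr_ge0// sqrtr_ge0.
apply: (@le_trans _ _ (n.*2%:R)%:E); last first.
  rewrite lee_fin -muln2 natrM mulrC -mulrA ler_pM2l// ler_pdivlMr//.
  apply: le_trans (ler_wpM2r (ltW s0) n2) _.
  by rewrite mulrDl divfK ?gt_eqF// mul1r lerD2l.
have w0 i := @tent_weight_gt0 R k n i k1.
apply: (qstar_le_finite_chain w0 (@tent_weight_eq0 R k n) (a := a)) => //.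
  move=> q; have [qn|qn] := ltnP q n.*2; last first.
    by rewrite (tent_weight_eq0 (n := n) (i := q.+1))// mul0r lexx ltW// (lt_trans ltr01).
  have [_ _ _] := ratio n q qn.
  rewrite lt_min => /andP[_]; rewrite ltr_norml => /andP[_ ?].
  by rewrite divr_ge0 ?(ltW (w0 _ _)) ?(ltnW qn)//=; lra.
have wN : tent_weight k n n.*2 = k%:R ^+ 2 :> R.
  by rewrite /tent_weight leqnn /tent subnn minn0.
have wz : tent_weight k n 0 = k%:R ^+ 2 :> R.
  by rewrite /tent_weight leq0n /tent min0n.
rewrite wz.
apply: (@le_trans _ _ (k%:R ^+ 2 * F 1 + 18 * D * n%:R)).
  (* At the top state the rate is 0 and the gap is [F 1 - a]; together with the term [a k^2] from
     state 0 this gives [k^2 F 1]. *)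
  rewrite big_nat_recr//= wN (tent_weight_eq0 (i := n.*2.+1))// mul0r.
  rewrite {2}/tangent_gap F00.
  suff : \sum_(0 <= i < n.*2) tent_weight k n i *
      tangent_gap F a (tent_weight k n i.+1 / tent_weight k n i) <= 18 * D * n%:R.
    lra.
  apply: (@le_trans _ _ (\sum_(0 <= i < n.*2) (9 * D))); last first.
    by rewrite sumr_const_nat subn0 -[leLHS]mulr_natl -muln2 natrM; lra.
  apply: ler_sum_nat => q /andP[_ qn].
  have [x0 wE l1' l2] := ratio n q qn; move: x0 wE l1' l2.
  set x := (tent k n q)%:R; set l := tent_weight k n q.+1 / _ => x0 -> l1' l2.
  have lr : `|l - 1| < r by move: l2; rewrite lt_min => /andP[].
  apply: le_trans (ler_wpM2l (sqr_ge0 x) (HD _ lr)) _.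
  move: l1'; rewrite ler_pdivlMr// => l1'.
  have : (`|l - 1| * x) ^+ 2 <= 3 ^+ 2.
    by rewrite lerXn2r ?nnegrE ?mulr_ge0// ltW.
  rewrite exprMn real_normK ?num_real// => H.
  have := ler_wpM2l (ltW D0) H; lra.
apply: le_trans (ler_wpM2l (ltW e0) (sum_tent_weight_ge k n)).
have nn : 1 <= n%:R :> R by rewrite ler1n.
apply: (@le_trans _ _ (B * n%:R / 3)).
  have := mulr_ge0 (mulr_ge0 (exprn_ge0 2 (ler0n R k)) F10) (_ : 0 <= n%:R - 1).
  by rewrite subr_ge0 => /(_ nn); rewrite /B; lra.
have : B <= eps * n%:R ^+ 2.
  rewrite -bs -es -exprMn lerXn2r ?nnegrE ?mulr_ge0 ?(ltW s0)//.
  by rewrite mulrC -ler_pdivrMr// ltW.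
move=> H; have := ler_wpM2r (ler0n R n) H; lra.
Qed.

(** * The order of [qstar] for small [eps] *)

Theorem theorem5p3 (R : realType) (lmax : R) (F : R -> R) :
  1 < lmax ->
  (* F : [0, lmax] -> R_+ with F(0) = 0 *)
  (forall x, x \in `[0, lmax] -> 0 <= F x) ->
  F 0 = 0 ->
  (* F is continuously differentiable on [0, lmax] (one-sided at the ends),
     with derivative F1; F1 has derivative F2 on (0, lmax), F2 continuous there;
     F2 has derivative F3 and F3 has derivative F4 on (0, lmax) *)
  forall F1 F2 F3 F4 : R -> R,
  (forall x, x \in `[0, lmax] -> deriv_within (I0 lmax) F x (F1 x)) ->
  {within I0 lmax, continuous F1} ->
  (forall x, x \in `]0, lmax[ -> is_derive x 1 F1 (F2 x)) ->
  (forall x, x \in `]0, lmax[ -> {for x, continuous F2}) ->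
  (forall x, x \in `]0, lmax[ -> is_derive x 1 F2 (F3 x)) ->
  (forall x, x \in `]0, lmax[ -> is_derive x 1 F3 (F4 x)) ->
  (* (i) *)
  (forall x, x \in `[0, 1[ -> ((F x)%:E < Fstar lmax F)%E) ->
  0 < F1 1 ->
  (* (ii) *)
  F2 1 < 0 ->
  (* (iii) *)
  (exists M : R, forall x, x \in `]0, lmax[ -> `|F3 x| <= M /\ `|F4 x| <= M) ->
  (* (iv) *)
  concave_like lmax F ->
  exists C1 C2 eps0 : R, [/\ 0 < C1, 0 < C2, 0 < eps0 &
    forall eps : R, 0 < eps <= eps0 ->
      ((C1 / Num.sqrt eps)%:E <= qstar lmax F eps /\
       qstar lmax F eps <= (C2 / Num.sqrt eps)%:E)%E].
Proof.
move=> l1 F0 F00 F1 F2 F3 F4 dF _ dF1 _ _ _ _ a0 b0 _ HF.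
have F0' x : 0 <= x <= lmax -> 0 <= F x by move=> xI; apply: F0; rewrite in_itv.
have dF' x : I0 lmax x -> deriv_within (I0 lmax) F x (F1 x) by exact: dF.
have cF := deriv_within_continuous dF'.
have one_in : 1 \in `]0, lmax[ by rewrite in_itv/= ltr01.
have I1 : 1 \in `[0, lmax] by exact: subset_itv_oo_cc one_in.
have G0 : forall x, 0 <= x <= lmax -> 0 <= tangent_gap F (F1 1) x.
  exact: tangent_gap_ge0 l1 HF (dF _ I1).
have FsE := Fstar_eq l1 F0' F00 cF (ltW a0) G0.
have F10 : 0 <= F 1 by exact: F0.
have aF : F1 1 <= F 1.
  by have := G0 0; rewrite /tangent_gap F00 lexx => /(_ ltac:(lra)); lra.
have [r r0 Hr] : exists2 r : R, 0 < r & forall x, `|x - 1| < r ->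
    - F2 1 / 4 * (x - 1) ^+ 2 <= tangent_gap F (F1 1) x <= - F2 1 * (x - 1) ^+ 2.
  apply: (@tangent_gap_local R F F1 1 (Num.min 1 (lmax - 1))) => //.
  - by rewrite lt_min ltr01 subr_gt0.
  - move=> x; rewrite lt_min !ltr_norml => ?.
    have xI : x \in `]0, lmax[ by rewrite in_itv/=; lra.
    by apply: (deriv_within_is_derive xI); apply: dF; exact: subset_itv_oo_cc xI.
  - exact: dF1.
have [C2 C20 up] : exists2 C : R, 0 < C & forall eps : R, 0 < eps <= 1 ->
    (qstar lmax F eps <= (C / Num.sqrt eps)%:E)%E.
  apply: (qstar_upper (a := F1 1) (D := - F2 1) (r := r)) => //; first by lra.
  by move=> x /Hr/andP[].
have [c c0 Hc] : exists2 c : R, 0 < c &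
    (forall x, 1 <= x <= lmax -> c * (x - 1) ^+ 2 <= tangent_gap F (F1 1) x) \/
    (forall x, 0 <= x <= 1 -> c * (x - 1) ^+ 2 <= tangent_gap F (F1 1) x).
  apply: (tangent_gap_quadratic (k := - F2 1 / 4) (r := r)) => //; first by lra.
  by move=> x /Hr/andP[].
pose K := (F1 1)^-1 + (1 + c) / (2 * c).
have K0 : 0 < K by rewrite addr_gt0 ?invr_gt0// divr_gt0//; lra.
(* The second bound on [eps] gives [K sqrt eps <= 1 / 4], as [mean_ge_of_sup_le] requires; with
   [B = K sqrt eps] its conclusion yields the constant [1 / (16 K)]. *)
exists (1 / (16 * K)), C2, (Num.min 1 ((1 / (4 * K)) ^+ 2)); split => //.
- by rewrite divr_gt0// mulr_gt0.
- by rewrite lt_min ltr01 exprn_gt0// divr_gt0// mulr_gt0.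
move=> eps; rewrite le_min => /and3P[e0 e1 eK].
split; last by apply: up; rewrite e0.
have s0 : 0 < Num.sqrt eps by rewrite sqrtr_gt0.
apply: le_ereal_inf_tmp => _ [pi [lam [lamP _ statP reg]] <-].
have K4 : K * Num.sqrt eps <= 1 / 4.
  have : Num.sqrt eps <= 1 / (4 * K).
    rewrite -(ger0_norm (_ : 0 <= 1 / (4 * K))) ?divr_ge0 ?mulr_ge0 ?(ltW K0)//.
    by rewrite -sqrtr_sqr ler_sqrt// exprn_ge0// divr_ge0// mulr_ge0// ltW.
  by rewrite ler_pdivlMr ?mulr_gt0//; lra.
have -> : 1 / (16 * K) / Num.sqrt eps = 1 / (16 * (K * Num.sqrt eps)).
  by field; rewrite !gt_eqF.
apply: (mean_ge_of_sup_le statP _ K4); first by rewrite mulr_gt0.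
move=> m; apply: (stationary_sup_le (ltW a0) F0' aF FsE G0 lamP statP a0 c0 _ reg Hc).
by rewrite e0.
Qed.
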